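(* Let $\sigma$ be a precomposition on a filtered commutative monoid $(\mathcal S,\oplus)$, and let $\gamma:\mathcal S\to\mathcal S$ be an idempotent monoid morphism ($\gamma\circ\gamma=\gamma$) such that $\gamma(\mathcal S_n)\subseteq\mathcal S_n$ for all $n\geq 1$ and $\sigma^{i,n}\gamma=\gamma\sigma^{i,n}$ for all $i\in\mathbb Z$, $n\geq1$. Let $\sim_\gamma$ be the monoid congruence on $\mathcal S$ defined by $s\sim_\gamma s'$ iff $\gamma(s)=\gamma(s')$, let $\equiv_\gamma$ be the operad congruence on $\mathrm{OP}(\sigma)$ defined by $a^{(n)}_s\equiv_\gamma a^{(n)}_{s'}$ iff $s\sim_\gamma s'$, and let $\bar\sigma$ be the precomposition on $\mathcal S/_{\sim_\gamma}$ given by $\bar\sigma^{i,n}([s]_{\sim_\gamma})=[\sigma^{i,n}(s)]_{\sim_\gamma}$. Then the operads $\mathrm{OP}(\sigma)/_{\equiv_\gamma}$ and $\mathrm{OP}(\bar\sigma)$ are isomorphic.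
   Context: Operads: a (nonsymmetric, set) operad is a graded set $P=\bigsqcup_{n\geq1}P_n$ with maps $\circ_i:P_n\times P_m\to P_{n+m-1}$ ($1\leq i\leq n$) and a unit $\mathbf 1\in P_1$ such that for $p_1\in P_n,p_2\in P_m,p_3\in P_p$: $(p_1\circ_ip_2)\circ_{j+m-1}p_3=(p_1\circ_jp_3)\circ_ip_2$ for $1\leq i<j\leq n$; $(p_1\circ_ip_2)\circ_{i+j-1}p_3=p_1\circ_i(p_2\circ_jp_3)$ for $1\leq i\leq n$, $1\leq j\leq m$; $p_1\circ_i\mathbf 1=p_1=\mathbf 1\circ_1p_1$. Isomorphisms are arity-preserving bijections preserving unit and all partial compositions. An operad congruence is an arity-preserving equivalence relation compatible with all partial compositions; the quotient is then an operad. Precompositions: let $\square$ be the monoid with generators $b_{i,n}$ ($i\in\mathbb Z$, $n\geq1$) and relations: $b_{i,n}=b_{0,n}$ for $i<0$; $b_{i,1}=1$ for all $i$; $b_{i,n}b_{j,m}=b_{j+n-1,m}b_{i,n}$ if $i\leq j$ or $i,j\leq0$; $b_{i+j,n}b_{i,m}=b_{i,n+m-1}$ if $0\leq j<m$. A filtered commutative monoid is a commutative monoid $(\mathcal S,\oplus)$ with unit $\mathbf 0_{\mathcal S}$ and submonoids $\mathcal S_1\subseteq\mathcal S_2\subseteq\cdots$ with $\mathcal S=\bigcup_n\mathcal S_n$. A precomposition on it is a monoid morphism from $\square$ to the monoid of monoid endomorphisms of $\mathcal S$ (under composition) such that, writing $\sigma^{i,n}$ for the image of $b_{i,n}$: $\sigma^{i,n}(\mathcal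 S_m)\subseteq\mathcal S_{n+m-1}$, and $\sigma^{i,n}(s)=s$ for $s\in\mathcal S_m$ whenever $i\geq m+1$. The operad $\mathrm{OP}(\sigma)$: its elements of arity $n$ are the symbols $a_s^{(n)}$, $s\in\mathcal S_n$, with $a_s^{(n)}\circ_ia_{s'}^{(m)}=a^{(n+m-1)}_{\sigma^{i,m}(s)\oplus\sigma^{0,i}(s')}$ for $1\leq i\leq n$ and unit $a^{(1)}_{\mathbf 0_{\mathcal S}}$. The quotient monoid $\mathcal S/_{\sim_\gamma}$ is filtered by the images of the $\mathcal S_n$. *)

(* Defs.v *)
From HB Require Import structures.
From mathcomp Require Import all_boot all_order all_algebra.
From mathcomp Require Import generic_quotient boolp classical_sets.
From mathcomp Require Import zify.
Set Implicit Arguments.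
Unset Strict Implicit.
Unset Printing Implicit Defensive.
Import Order.TTheory GRing.Theory Num.Theory.
Local Open Scope ring_scope.
Local Open Scope quotient_scope.

(* The graded set is given by its total space together with the arity map.
   [ocomp p i q] is the partial composition p o_i q; it is meaningful only for
   1 <= i <= arity p, and its other values are arbitrary: no definition below
   looks at them. *)
Record operad := Operad {
  operad_sort :> choiceType;
  arity : operad_sort -> nat;
  ocomp : operad_sort -> nat -> operad_sort -> operad_sort;
  ounit : operad_sort;
  arity_gt0 : forall p, (0 < arity p)%N;
  arity_comp : forall p i q, (1 <= i <= arity p)%N ->
    arity (ocomp p i q) = (arity p + arity q - 1)%N;
  arity_unit : arity ounit = 1%N;
  ocomp_par : forall p1 p2 p3 i j, (1 <= i)%N -> (i < j)%N ->
    (j <= arity p1)%N ->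
    ocomp (ocomp p1 i p2) (j + arity p2 - 1)%N p3 =
    ocomp (ocomp p1 j p3) i p2;
  ocomp_seq : forall p1 p2 p3 i j, (1 <= i <= arity p1)%N ->
    (1 <= j <= arity p2)%N ->
    ocomp (ocomp p1 i p2) (i + j - 1)%N p3 = ocomp p1 i (ocomp p2 j p3);
  ocomp1r : forall p i, (1 <= i <= arity p)%N -> ocomp p i ounit = p;
  ocomp1l : forall p, ocomp ounit 1 p = p
}.

Definition operad_isomorphism (P Q : operad) (f : P -> Q) : Prop :=
  [/\ bijective f,
      forall p, arity (f p) = arity p,
      f (ounit P) = ounit Q
    & forall p i q, (1 <= i <= arity p)%N ->
        f (ocomp p i q) = ocomp (f p) i (f q)].

Definition operad_isomorphic (P Q : operad) : Prop :=
  exists f : P -> Q, operad_isomorphism f.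

Record operad_congruence (P : operad) := OperadCongruence {
  ocong_rel :> equiv_rel P;
  ocong_arity : forall p q, ocong_rel p q -> arity p = arity q;
  ocong_comp : forall p p' q q' i, ocong_rel p p' -> ocong_rel q q' ->
    (1 <= i <= arity p)%N -> ocong_rel (ocomp p i q) (ocomp p' i q')
}.

Section QuotientOperad.
Variables (P : operad) (c : operad_congruence P).
Notation Q := {eq_quot c}.

Definition oquot_arity (x : Q) : nat := arity (repr x).
Definition oquot_comp (x : Q) (i : nat) (y : Q) : Q :=
  \pi_Q (ocomp (repr x) i (repr y)).
Definition oquot_unit : Q := \pi_Q (ounit P).

Lemma oquot_arityE p : oquot_arity (\pi_Q p) = arity p.
Proof.
by apply: (@ocong_arity _ c); rewrite -eqmodE reprK.
Qed.

Lemma oquot_compE p i q : (1 <= i <= arity p)%N ->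
  oquot_comp (\pi_Q p) i (\pi_Q q) = \pi_Q (ocomp p i q).
Proof.
move=> hi; apply/eqmodP/ocong_comp; rewrite -?eqmodE ?reprK //.
by have := oquot_arityE p; rewrite /oquot_arity => ->.
Qed.

Fact oquot_arity_gt0 x : (0 < oquot_arity x)%N.
Proof. exact: arity_gt0. Qed.

Fact oquot_arity_comp x i y : (1 <= i <= oquot_arity x)%N ->
  oquot_arity (oquot_comp x i y) = (oquot_arity x + oquot_arity y - 1)%N.
Proof.
by move=> hi; rewrite oquot_arityE arity_comp.
Qed.

Fact oquot_arity_unit : oquot_arity oquot_unit = 1%N.
Proof. by rewrite oquot_arityE arity_unit. Qed.

Fact oquot_par x1 x2 x3 i j : (1 <= i)%N -> (i < j)%N ->
  (j <= oquot_arity x1)%N ->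
  oquot_comp (oquot_comp x1 i x2) (j + oquot_arity x2 - 1)%N x3 =
  oquot_comp (oquot_comp x1 j x3) i x2.
Proof.
elim/quotW: x1 => p1; elim/quotW: x2 => p2; elim/quotW: x3 => p3.
rewrite !oquot_arityE => i1 ij jp.
have ip : (i <= arity p1)%N by apply: leq_trans jp; apply: ltnW.
have j1 : (1 <= j)%N by apply: leq_trans ij.
have := arity_gt0 p2; have := arity_gt0 p3 => p30 p20.
rewrite (@oquot_compE p1 i) ?i1 // (@oquot_compE p1 j) ?j1 //.
by rewrite !oquot_compE ?ocomp_par // arity_comp ?i1 ?j1 //=; lia.
Qed.

Fact oquot_seq x1 x2 x3 i j : (1 <= i <= oquot_arity x1)%N ->
  (1 <= j <= oquot_arity x2)%N ->
  oquot_comp (oquot_comp x1 i x2) (i + j - 1)%N x3 =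
  oquot_comp x1 i (oquot_comp x2 j x3).
Proof.
elim/quotW: x1 => p1; elim/quotW: x2 => p2; elim/quotW: x3 => p3.
rewrite !oquot_arityE => hi hj.
rewrite (oquot_compE _ hi) (oquot_compE _ hj) (oquot_compE _ hi).
by rewrite oquot_compE ?ocomp_seq ?arity_comp //; lia.
Qed.

Fact oquot_comp1r x i : (1 <= i <= oquot_arity x)%N ->
  oquot_comp x i oquot_unit = x.
Proof.
by elim/quotW: x => p; rewrite oquot_arityE => hi; rewrite oquot_compE ?ocomp1r.
Qed.

Fact oquot_comp1l x : oquot_comp oquot_unit 1 x = x.
Proof.
by elim/quotW: x => p; rewrite oquot_compE ?ocomp1l ?arity_unit.
Qed.

Definition quotient_operad : operad :=
  @Operad Q oquot_arity oquot_comp oquot_unit oquot_arity_gt0 oquot_arity_comp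
    oquot_arity_unit oquot_par oquot_seq oquot_comp1r oquot_comp1l.

End QuotientOperad.

Section PresentedMonoid.
Variables (X : choiceType) (R : seq X -> seq X -> Prop).

Inductive pres_cong : seq X -> seq X -> Prop :=
| PresRel u v : R u v -> pres_cong u v
| PresRefl u : pres_cong u u
| PresSym u v : pres_cong u v -> pres_cong v u
| PresTrans u v w : pres_cong u v -> pres_cong v w -> pres_cong u w
| PresCat u u' v v' : pres_cong u u' -> pres_cong v v' ->
    pres_cong (u ++ v) (u' ++ v').

Definition pres_rel : rel (seq X) := fun u v => `[< pres_cong u v >].

Fact pres_rel_refl : reflexive pres_rel.
Proof. by move=> u; apply/asboolP/PresRefl. Qed.

Fact pres_rel_sym : symmetric pres_rel.
Proof. by move=> u v; apply/asboolP/asboolP; apply: PresSym. Qed.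

Fact pres_rel_trans : transitive pres_rel.
Proof.
by move=> v u w /asboolP uv /asboolP vw; apply/asboolP/(PresTrans uv vw).
Qed.

Definition pres_equiv : equiv_rel (seq X) :=
  EquivRel pres_rel pres_rel_refl pres_rel_sym pres_rel_trans.

Definition presented_monoid : Type := {eq_quot pres_equiv}.
HB.instance Definition _ := Choice.on presented_monoid.

Definition pres_class (u : seq X) : presented_monoid :=
  \pi_({eq_quot pres_equiv}) u.

Definition pres_word (x : presented_monoid) : seq X :=
  repr (x : {eq_quot pres_equiv}).

Definition pres_mul (x y : presented_monoid) : presented_monoid :=
  pres_class (pres_word x ++ pres_word y).
Definition pres_one : presented_monoid := pres_class [::].

Lemma pres_wordK : cancel pres_word pres_class.
Proof. by move=> x; rewrite /pres_class /pres_word reprK. Qed.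

Lemma pres_classP u v : reflect (pres_class u = pres_class v) (pres_rel u v).
Proof. exact: (eqmodP pres_equiv). Qed.

Lemma pres_classM u v : pres_mul (pres_class u) (pres_class v) =
  pres_class (u ++ v).
Proof.
apply/pres_classP/asboolP/PresCat; apply/asboolP/pres_classP;
  exact: pres_wordK.
Qed.

Fact pres_mulA : associative pres_mul.
Proof.
move=> x y z; rewrite -(pres_wordK x) -(pres_wordK y) -(pres_wordK z).
by rewrite !pres_classM catA.
Qed.

Fact pres_mul1 : left_id pres_one pres_mul.
Proof. by move=> x; rewrite -(pres_wordK x) pres_classM. Qed.

Fact pres_mulr1 : right_id pres_one pres_mul.
Proof. by move=> x; rewrite -(pres_wordK x) pres_classM cats0. Qed.

HB.instance Definition _ :=
  isMonoid.Build presented_monoid pres_mulA pres_mul1 pres_mulr1.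

End PresentedMonoid.

(* The pair (i, k) is the generator b_{i,k+1}; hence [bgen i n] is b_{i,n} for
   n >= 1, and each generator is obtained exactly once in this way.  The value
   of [bgen] and [b_] at n = 0 is irrelevant. *)
Definition bgen (i : int) (n : nat) : int * nat := (i, n.-1).

Inductive box_rel : seq (int * nat) -> seq (int * nat) -> Prop :=
| BoxNeg i n : i < 0 -> (1 <= n)%N ->
    box_rel [:: bgen i n] [:: bgen 0 n]
| BoxOne i : box_rel [:: bgen i 1] [::]
| BoxComm i j n m : (1 <= n)%N -> (1 <= m)%N ->
    i <= j \/ (i <= 0 /\ j <= 0) ->
    box_rel [:: bgen i n; bgen j m] [:: bgen (j + n%:Z - 1) m; bgen i n]
| BoxFuse i (j : nat) n m : (1 <= n)%N -> (1 <= m)%N -> (j < m)%N ->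
    box_rel [:: bgen (i + j%:Z) n; bgen i m] [:: bgen i (n + m - 1)%N].

Definition box : monoidType := presented_monoid box_rel.

Definition b_ (i : int) (n : nat) : box := pres_class box_rel [:: bgen i n].

(* Only the levels n >= 1 matter; [flevel 0] is unconstrained and unused. *)
Record filtration (S : nmodType) := Filtration {
  flevel :> nat -> set S;
  flevel0 : forall n, (1 <= n)%N -> flevel n 0;
  flevelD : forall n s t, (1 <= n)%N ->
    flevel n s -> flevel n t -> flevel n (s + t);
  flevelS : forall n, (1 <= n)%N -> (flevel n `<=` flevel n.+1)%classic;
  flevel_cover : forall s, exists2 n, (1 <= n)%N & flevel n s
}.

Definition endo (S : nmodType) : Type := {additive S -> S}.
HB.instance Definition _ (S : nmodType) := gen_eqMixin (endo S).
HB.instance Definition _ (S : nmodType) := gen_choiceMixin (endo S).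

Section Endo.
Variable S : nmodType.
Implicit Types f g h : endo S.

Definition endo_fun f : S -> S := (f : {additive S -> S}).

Lemma endoP f g : endo_fun f =1 endo_fun g -> f = g.
Proof.
case: f => f cf; case: g => g cg /funext /= e; rewrite /endo_fun /= in e.
case: _ / e cg => cg; suff -> : cf = cg by [].
case: cf cg => [[a]] [[b]]; suff -> : a = b by [].
by case: a b => a1 a2 [b1 b2]; congr pair; apply: Prop_irrelevance.
Qed.

Definition endo_comp f g : endo S :=
  ((f : {additive S -> S}) \o (g : {additive S -> S}))%FUN.
Definition endo_id : endo S := (idfun : {additive S -> S}).

Fact endo_compA : associative endo_comp.
Proof. by move=> f g h; apply: endoP. Qed.
Fact endo_comp1l : left_id endo_id endo_comp.
Proof. by move=> f; apply: endoP. Qed.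
Fact endo_comp1r : right_id endo_id endo_comp.
Proof. by move=> f; apply: endoP. Qed.

HB.instance Definition _ :=
  isMonoid.Build (endo S) endo_compA endo_comp1l endo_comp1r.

End Endo.

Coercion endo_fun : endo >-> Funclass.

Record precomposition (S : nmodType) (F : filtration S) := Precomposition {
  pc_mor : UMagmaMorphism.type box (endo S);
  pc_level : forall i n m s, (1 <= n)%N -> (1 <= m)%N ->
    F m s -> F (n + m - 1)%N (pc_mor (b_ i n) s);
  pc_stable : forall i n m s, (1 <= n)%N -> (1 <= m)%N ->
    F m s -> m%:Z + 1 <= i -> pc_mor (b_ i n) s = s
}.

Definition pc_act (S : nmodType) (F : filtration S) (sigma : precomposition F)
  (i : int) (n : nat) : S -> S := pc_mor sigma (b_ i n).
Coercion pc_act : precomposition >-> Funclass.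

Section PrecompositionTheory.
Variables (S : nmodType) (F : filtration S) (sigma : precomposition F).

Lemma flevel_le n m : (1 <= n)%N -> (n <= m)%N -> (F n `<=` F m)%classic.
Proof.
move=> n1 /subnK <-; elim: (m - n)%N => [//|k ih] s /ih.
by apply: flevelS; rewrite addn_gt0 n1 orbT.
Qed.

Lemma pc_actD i n : {morph sigma i n : s t / s + t}.
Proof. exact: raddfD. Qed.

Lemma pc_act0 i n : sigma i n 0 = 0.
Proof. exact: raddf0. Qed.

Lemma b_mul i n j m :
  (b_ i n * b_ j m)%g = pres_class box_rel [:: bgen i n; bgen j m].
Proof. exact: pres_classM. Qed.

Lemma pc_actM i n j m s : sigma i n (sigma j m s) =
  pc_mor sigma (pres_class box_rel [:: bgen i n; bgen j m]) s.
Proof. by rewrite -b_mul gmulfM. Qed.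

Lemma pc_act_one i s : sigma i 1 s = s.
Proof.
have e : b_ i 1 = 1%g by apply/pres_classP/asboolP/PresRel/BoxOne.
by rewrite /pc_act e gmulf1.
Qed.

Lemma pc_act_comm i j n m s : (1 <= n)%N -> (1 <= m)%N ->
  i <= j \/ (i <= 0 /\ j <= 0) ->
  sigma i n (sigma j m s) = sigma (j + n%:Z - 1) m (sigma i n s).
Proof.
move=> n1 m1 ij; rewrite !pc_actM; congr (pc_mor sigma _ s).
by apply/pres_classP/asboolP/PresRel/BoxComm.
Qed.

Lemma pc_act_fuse i (j n m : nat) s : (1 <= n)%N -> (1 <= m)%N -> (j < m)%N ->
  sigma (i + j%:Z) n (sigma i m s) = sigma i (n + m - 1)%N s.
Proof.
move=> n1 m1 jm; rewrite !pc_actM /pc_act; congr (pc_mor sigma _ s).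
by apply/pres_classP/asboolP/PresRel/BoxFuse.
Qed.

End PrecompositionTheory.

Section OP.
Variables (S : nmodType) (F : filtration S) (sigma : precomposition F).

(* The symbol a_s^(n) is encoded as the pair (n, s), with 1 <= n and s in the
   n-th level of the filtration. *)
Definition op_symbol : Type :=
  {p : nat * S | (1 <= p.1)%N && (p.2 \in F p.1)}.
HB.instance Definition _ := Choice.on op_symbol.

Definition op_arity (a : op_symbol) : nat := (val a).1.
Definition op_label (a : op_symbol) : S := (val a).2.

Fact op_symbol_proof n s : (1 <= n)%N -> F n s ->
  (1 <= (n, s).1)%N && ((n, s).2 \in F (n, s).1).
Proof. by move=> n1 hs; rewrite n1 /= mem_set. Qed.

Definition op_sym n s (n1 : (1 <= n)%N) (hs : F n s) : op_symbol :=
  Sub (n, s) (op_symbol_proof n1 hs).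

(* When 1 <= i <= op_arity a the pair below satisfies the subtype predicate
   (see [op_compE]), so the default value [a] of [insubd] is never used. *)
Definition op_comp (a : op_symbol) (i : nat) (a' : op_symbol) : op_symbol :=
  insubd a ((op_arity a + op_arity a' - 1)%N,
    sigma i%:Z (op_arity a') (op_label a) + sigma 0 i (op_label a')).

Lemma op_arity_gt0 a : (1 <= op_arity a)%N.
Proof. by case/andP: (valP a). Qed.

Lemma op_labelP a : F (op_arity a) (op_label a).
Proof. by case/andP: (valP a) => _ /set_mem. Qed.

Lemma op_symbolP a b :
  op_arity a = op_arity b -> op_label a = op_label b -> a = b.
Proof.
rewrite /op_arity /op_label => e1 e2; apply: val_inj.
by rewrite [val a]surjective_pairing [val b]surjective_pairing e1 e2.
Qed.

Lemma op_compE a i a' : (1 <= i <= op_arity a)%N ->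
  val (op_comp a i a') = ((op_arity a + op_arity a' - 1)%N,
    sigma i%:Z (op_arity a') (op_label a) + sigma 0 i (op_label a')).
Proof.
move=> /andP[i1 ia]; have a1 := op_arity_gt0 a; have a1' := op_arity_gt0 a'.
rewrite /op_comp insubdK //; apply/andP; split; rewrite /=; first by lia.
apply/mem_set/flevelD; first by lia.
  by rewrite addnC; apply: pc_level => //; apply: op_labelP.
apply: (@flevel_le _ _ (i + op_arity a' - 1)); [lia | lia |].
by apply: pc_level => //; apply: op_labelP.
Qed.

Fact op_arity_comp a i a' : (1 <= i <= op_arity a)%N ->
  op_arity (op_comp a i a') = (op_arity a + op_arity a' - 1)%N.
Proof. by move=> hi; rewrite /op_arity op_compE. Qed.

Lemma op_label_comp a i a' : (1 <= i <= op_arity a)%N ->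
  op_label (op_comp a i a') =
  sigma i%:Z (op_arity a') (op_label a) + sigma 0 i (op_label a').
Proof. by move=> hi; rewrite {1}/op_label op_compE. Qed.

Definition op_unit : op_symbol := op_sym (leqnn 1) (flevel0 F (leqnn 1)).

Fact op_arity_unit : op_arity op_unit = 1%N.
Proof. by []. Qed.

Fact op_par a1 a2 a3 i j : (1 <= i)%N -> (i < j)%N -> (j <= op_arity a1)%N ->
  op_comp (op_comp a1 i a2) (j + op_arity a2 - 1)%N a3 =
  op_comp (op_comp a1 j a3) i a2.
Proof.
move=> i1 ij ja.
have := op_arity_gt0 a2; have := op_arity_gt0 a3 => h3 h2.
have hi : (1 <= i <= op_arity a1)%N by lia.
have hj : (1 <= j <= op_arity a1)%N by lia.
apply: op_symbolP.
  by rewrite !op_arity_comp ?op_arity_comp //; lia.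
rewrite !op_label_comp ?op_arity_comp //; try lia.
rewrite !pc_actD; set s1 := op_label a1; set s2 := op_label a2.
set s3 := op_label a3; set m := op_arity a2; set p := op_arity a3.
have -> : sigma (j + m - 1)%N%:Z p (sigma i%:Z m s1) =
          sigma i%:Z m (sigma j%:Z p s1).
  rewrite [RHS]pc_act_comm //; last by left; lia.
  by congr (sigma _ _ _); lia.
have -> : sigma (j + m - 1)%N%:Z p (sigma 0 i s2) = sigma 0 i s2.
  apply: (@pc_stable _ _ sigma _ _ (i + m - 1)%N) => //; try lia.
  by apply: pc_level => //; apply: op_labelP.
rewrite -!addrA; congr (_ + _); rewrite addrC; congr (_ + _).
rewrite -[i%:Z in RHS]add0r pc_act_fuse //; last by lia.
by congr (sigma _ _ _); lia.
Qed.

Fact op_seq a1 a2 a3 i j : (1 <= i <= op_arity a1)%N ->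
  (1 <= j <= op_arity a2)%N ->
  op_comp (op_comp a1 i a2) (i + j - 1)%N a3 = op_comp a1 i (op_comp a2 j a3).
Proof.
move=> hi hj.
have := op_arity_gt0 a2; have := op_arity_gt0 a3 => h3 h2.
apply: op_symbolP.
  by rewrite !op_arity_comp ?op_arity_comp //; lia.
rewrite !op_label_comp ?op_arity_comp //; try lia.
rewrite !pc_actD; set s1 := op_label a1; set s2 := op_label a2.
set s3 := op_label a3; set m := op_arity a2; set p := op_arity a3.
rewrite -addrA; congr (_ + _); last congr (_ + _).
- have -> : (i + j - 1)%N%:Z = i%:Z + (j - 1)%N%:Z by lia.
  rewrite pc_act_fuse //; try lia.
  by congr (sigma _ _ _); rewrite addnC.
- rewrite [RHS]pc_act_comm //; [|lia|by left; lia].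
  by congr (sigma _ _ _); lia.
- have := @pc_act_fuse _ _ sigma 0 0 i j s3.
  rewrite addr0 => -> //; lia.
Qed.

Fact op_comp1r a i : (1 <= i <= op_arity a)%N -> op_comp a i op_unit = a.
Proof.
move=> hi; apply: op_symbolP.
  by rewrite op_arity_comp // op_arity_unit; lia.
by rewrite op_label_comp // op_arity_unit pc_act_one pc_act0 addr0.
Qed.

Fact op_comp1l a : op_comp op_unit 1 a = a.
Proof.
have h := op_arity_gt0 a; apply: op_symbolP.
  by rewrite op_arity_comp // op_arity_unit; lia.
by rewrite op_label_comp // pc_act0 pc_act_one add0r.
Qed.

Definition OP : operad :=
  @Operad op_symbol op_arity op_comp op_unit op_arity_gt0 op_arity_comp
    op_arity_unit op_par op_seq op_comp1r op_comp1l.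

End OP.

Record monoid_congruence (S : nmodType) := MonoidCongruence {
  mcong_rel :> equiv_rel S;
  mcongD : forall s s' t t', mcong_rel s s' -> mcong_rel t t' ->
    mcong_rel (s + t) (s' + t')
}.

Section QuotientMonoid.
Variables (S : nmodType) (c : monoid_congruence S).

Definition mquot : Type := {eq_quot c}.
HB.instance Definition _ := Choice.on mquot.

Definition mclass (s : S) : mquot := \pi_({eq_quot c}) s.
Definition mrepr (x : mquot) : S := repr (x : {eq_quot c}).

Lemma mreprK : cancel mrepr mclass.
Proof. by move=> x; rewrite /mclass /mrepr reprK. Qed.

Lemma mclassP s t : reflect (mclass s = mclass t) (c s t).
Proof. exact: (eqmodP c). Qed.

Definition mquot_add (x y : mquot) : mquot := mclass (mrepr x + mrepr y).
Definition mquot_zero : mquot := mclass 0.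

Fact mclass_add s t : mquot_add (mclass s) (mclass t) = mclass (s + t).
Proof. by apply/mclassP/mcongD; apply/mclassP; rewrite mreprK. Qed.

Fact mquot_addA : associative mquot_add.
Proof.
move=> x y z; rewrite -(mreprK x) -(mreprK y) -(mreprK z).
by rewrite !mclass_add addrA.
Qed.
Fact mquot_addC : commutative mquot_add.
Proof.
by move=> x y; rewrite -(mreprK x) -(mreprK y) !mclass_add addrC.
Qed.
Fact mquot_add0 : left_id mquot_zero mquot_add.
Proof. by move=> x; rewrite -(mreprK x) mclass_add add0r. Qed.

HB.instance Definition _ :=
  GRing.isNmodule.Build mquot mquot_addA mquot_addC mquot_add0.

Lemma mclassD : {morph mclass : s t / s + t}.
Proof. by move=> s t; rewrite -mclass_add. Qed.

Variable F : filtration S.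

Definition mquot_level (n : nat) : set mquot := (mclass @` F n)%classic.

Fact mquot_level0 n : (1 <= n)%N -> mquot_level n 0.
Proof. by move=> n1; exists 0 => //; apply: flevel0. Qed.
Fact mquot_levelD n x y : (1 <= n)%N ->
  mquot_level n x -> mquot_level n y -> mquot_level n (x + y).
Proof.
move=> n1 [s hs <-] [t ht <-]; exists (s + t); last exact: mclassD.
exact: flevelD.
Qed.
Fact mquot_levelS n : (1 <= n)%N ->
  (mquot_level n `<=` mquot_level n.+1)%classic.
Proof. by move=> n1 _ [s hs <-]; exists s => //; apply: flevelS. Qed.
Fact mquot_level_cover x : exists2 n, (1 <= n)%N & mquot_level n x.
Proof.
have [n n1 hn] := flevel_cover F (mrepr x).
by exists n => //; exists (mrepr x) => //; apply: mreprK.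
Qed.

Definition quotient_filtration : filtration mquot :=
  @Filtration mquot mquot_level mquot_level0 mquot_levelD mquot_levelS
    mquot_level_cover.

End QuotientMonoid.

Section Gamma.
Variables (S : nmodType) (gamma : {additive S -> S}).

Definition sim_rel : rel S := fun s s' => gamma s == gamma s'.

Fact sim_refl : reflexive sim_rel.
Proof. by move=> s; apply: eqxx. Qed.
Fact sim_sym : symmetric sim_rel.
Proof. by move=> s t; apply: eq_sym. Qed.
Fact sim_trans : transitive sim_rel.
Proof. by move=> t s u /eqP st /eqP tu; apply/eqP; rewrite st. Qed.

Definition sim_equiv : equiv_rel S :=
  EquivRel sim_rel sim_refl sim_sym sim_trans.

Fact simD s s' t t' :
  sim_equiv s s' -> sim_equiv t t' -> sim_equiv (s + t) (s' + t').
Proof. by move=> /eqP hs /eqP ht; apply/eqP; rewrite !raddfD /= hs ht. Qed.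

Definition sim : monoid_congruence S := @MonoidCongruence S sim_equiv simD.

Variables (F : filtration S) (sigma : precomposition F).
Hypothesis sigma_gamma : forall i n s, (1 <= n)%N ->
  sigma i n (gamma s) = gamma (sigma i n s).

Lemma sigma_sim i n s t : (1 <= n)%N ->
  sim s t -> sim (sigma i n s) (sigma i n t).
Proof. by move=> n1 /eqP st; apply/eqP; rewrite -!sigma_gamma // st. Qed.

Definition equiv_gamma_rel : rel (OP sigma) := fun a b =>
  (op_arity a == op_arity b) && sim (op_label a) (op_label b).

Fact equiv_gamma_refl : reflexive equiv_gamma_rel.
Proof. by move=> a; rewrite /equiv_gamma_rel eqxx; apply: sim_refl. Qed.
Fact equiv_gamma_sym : symmetric equiv_gamma_rel.
Proof.
by move=> a b; rewrite /equiv_gamma_rel eq_sym; congr andb; apply: sim_sym.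
Qed.
Fact equiv_gamma_trans : transitive equiv_gamma_rel.
Proof.
move=> b a c /andP[/eqP e1 h1] /andP[/eqP e2 h2].
by apply/andP; split; [rewrite e1 e2 | apply: sim_trans h1 h2].
Qed.

Definition equiv_gamma_equiv : equiv_rel (OP sigma) :=
  EquivRel equiv_gamma_rel equiv_gamma_refl equiv_gamma_sym equiv_gamma_trans.

Fact equiv_gamma_arity (a b : OP sigma) :
  equiv_gamma_equiv a b -> arity a = arity b.
Proof. by case/andP=> /eqP. Qed.

Fact equiv_gamma_comp (a a' b b' : OP sigma) i :
  equiv_gamma_equiv a a' -> equiv_gamma_equiv b b' ->
  (1 <= i <= arity a)%N ->
  equiv_gamma_equiv (ocomp a i b) (ocomp a' i b').
Proof.
move=> /andP[/eqP ea sa] /andP[/eqP eb sb] hi.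
have hi' : (1 <= i <= op_arity a')%N by rewrite -ea.
apply/andP; split; first by rewrite !op_arity_comp // ea eb.
rewrite !op_label_comp // -eb; have b1 := op_arity_gt0 b.
apply: simD; apply: sigma_sim => //; by case/andP: hi.
Qed.

Definition equiv_gamma : operad_congruence (OP sigma) :=
  @OperadCongruence (OP sigma) equiv_gamma_equiv equiv_gamma_arity
    equiv_gamma_comp.

Lemma pc_mor_sim x s t : sim s t -> sim (pc_mor sigma x s) (pc_mor sigma x t).
Proof.
rewrite -(pres_wordK x); elim: (pres_word x) s t => [|[i k] u ih] s t st.
  by rewrite -[pres_class _ _]/(1%g : box) gmulf1.
rewrite -cat1s -pres_classM -[pres_mul _ _]/(b_ i k.+1 * pres_class _ u)%g.
by rewrite gmulfM; apply: sigma_sim => //; apply: ih.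
Qed.

Definition bar_fun (x : box) (y : mquot sim) : mquot sim :=
  mclass sim (pc_mor sigma x (mrepr y)).

Lemma bar_funE x s : bar_fun x (mclass sim s) = mclass sim (pc_mor sigma x s).
Proof. by apply/mclassP/pc_mor_sim/mclassP; rewrite mreprK. Qed.

Fact bar_fun_nmod x : nmod_morphism (bar_fun x).
Proof.
split; first by rewrite -[0]/(mclass sim 0) bar_funE [pc_mor _ _ _]raddf0.
move=> y z; rewrite -(mreprK y) -(mreprK z) -mclassD !bar_funE.
by rewrite [pc_mor _ _ _]raddfD mclassD.
Qed.

HB.instance Definition _ x :=
  GRing.isNmodMorphism.Build _ _ (bar_fun x) (bar_fun_nmod x).

Definition bar_endo (x : box) : endo (mquot sim) :=
  (bar_fun x : {additive mquot sim -> mquot sim}).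

Fact bar_endo_morphism : monoid.monoid_morphism bar_endo.
Proof.
split=> [|x y]; apply: endoP => z; rewrite -(mreprK z) /=.
  by rewrite [LHS]bar_funE gmulf1.
rewrite [LHS]bar_funE gmulfM.
by rewrite !bar_funE.
Qed.

HB.instance Definition _ :=
  isUMagmaMorphism.Build _ _ bar_endo bar_endo_morphism.

Definition bar_mor : UMagmaMorphism.type box (endo (mquot sim)) := bar_endo.

Fact bar_level i n m y : (1 <= n)%N -> (1 <= m)%N ->
  quotient_filtration sim F m y ->
  quotient_filtration sim F (n + m - 1)%N (bar_mor (b_ i n) y).
Proof.
move=> n1 m1 [s hs <-]; exists (sigma i n s); first exact: pc_level.
by rewrite [RHS]bar_funE.
Qed.

Fact bar_stable i n m y : (1 <= n)%N -> (1 <= m)%N ->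
  quotient_filtration sim F m y -> m%:Z + 1 <= i -> bar_mor (b_ i n) y = y.
Proof.
move=> n1 m1 [s hs <-] mi; rewrite [LHS]bar_funE.
by congr mclass; apply: pc_stable hs mi.
Qed.

Definition bar : precomposition (quotient_filtration sim F) :=
  @Precomposition _ _ bar_mor bar_level bar_stable.

Lemma barE i n s : bar i n (mclass sim s) = mclass sim (sigma i n s).
Proof. exact: bar_funE. Qed.

End Gamma.

(* Main.v *)
(* The map a_s^(n) |-> a_[s]^(n) from OP(sigma) to OP(sigma-bar) is a
   surjective operad morphism whose kernel is the congruence induced by gamma;
   the result is the first isomorphism theorem for operads. *)
Require Import Defs.
From mathcomp Require Import all_boot all_order all_algebra.
From mathcomp Require Import generic_quotient boolp.

Local Open Scope ring_scope.
Local Open Scope quotient_scope.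

(** As [c] is exactly the kernel of [h], the value of [h] on a class does not depend on the
    representative, and distinct classes have distinct values. *)
Lemma quotient_operad_isomorphic (P Q : operad) (c : operad_congruence P)
  (h : P -> Q) :
  (forall p, arity (h p) = arity p) -> h (ounit P) = ounit Q ->
  (forall p i q, (1 <= i <= arity p)%N ->
     h (ocomp p i q) = ocomp (h p) i (h q)) ->
  (forall p q, c p q <-> h p = h q) -> (forall y, exists p, h p = y) ->
  operad_isomorphic (quotient_operad c) Q.
Proof.
move=> hA hU hC hker /choice [g gK].
pose piQ := \pi_({eq_quot c}) : P -> quotient_operad c.
pose f (x : quotient_operad c) := h (repr (x : {eq_quot c})).
have fE p : f (piQ p) = h p by apply/hker; rewrite -eqmodE reprK.
exists f; split.
(* The inverse projects the section [g] of [h] to the quotient. The class of [g y] is independent of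
   the choice of [g], again by the kernel condition. *)
- exists (fun y => piQ (g y)) => [x|y]; last by rewrite fE gK.
  rewrite -[RHS](reprK (x : {eq_quot c})).
  by apply/eqmodP/hker; rewrite gK.
- by move=> x; apply: hA.
- by rewrite [ounit _]/(piQ (ounit P)) fE.
(* Composition in the quotient is by definition the class of the composite of representatives. *)
- by move=> x i y hi; rewrite [ocomp x i y]/(piQ _) fE hC.
Qed.

Section ClassMap.
Context {S : nmodType} {F : filtration S} {sigma : precomposition F}.
Context {gamma : {additive S -> S}}.
Context (sigma_gamma : forall (i : int) (n : nat) (s : S),
  (1 <= n)%N -> sigma i n (gamma s) = gamma (sigma i n s)).

Lemma quotient_levelP {n s} : F n s ->
  quotient_filtration (sim gamma) F n (mclass (sim gamma) s).
Proof. by exists s. Qed.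

Definition op_class (a : OP sigma) : OP (bar sigma_gamma) :=
  op_sym (op_arity_gt0 a) (quotient_levelP (op_labelP a)).

Lemma op_class_surj (b : OP (bar sigma_gamma)) : exists a, op_class a = b.
Proof.
(* Level n of the quotient is the image of level n of [S], so the label of [b] lifts without raising
   the arity. *)
have [s hs eb] := op_labelP b.
exists (op_sym (op_arity_gt0 b) hs); exact: op_symbolP.
Qed.

Lemma op_class_ker a b : equiv_gamma sigma_gamma a b <-> op_class a = op_class b.
Proof.
split=> [/andP[/eqP eA /mclassP eL]|e]; first exact: op_symbolP.
apply/andP; split; first exact/eqP/(congr1 (@op_arity _ _) e).
exact/mclassP/(congr1 (@op_label _ _) e).
Qed.

Lemma op_class_comp (a : OP sigma) i (b : OP sigma) :
  (1 <= i <= op_arity a)%N ->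
  op_class (ocomp a i b) = ocomp (op_class a) i (op_class b).
Proof.
move=> hi; apply: op_symbolP.
  by rewrite [LHS]op_arity_comp // [RHS]op_arity_comp.
(* Both summands of the label are classes of [sigma] applied to labels in [S], and additivity of
   [mclass] merges them. *)
rewrite [RHS]op_label_comp // !barE -mclassD.
by congr mclass; rewrite op_label_comp.
Qed.

End ClassMap.

Theorem theorem2 (S : nmodType) (F : filtration S) (sigma : precomposition F)
  (gamma : {additive S -> S})
  (gamma_idem : forall s : S, gamma (gamma s) = gamma s)
  (gamma_level : forall (n : nat) (s : S),
     (1 <= n)%N -> F n s -> F n (gamma s))
  (sigma_gamma : forall (i : int) (n : nat) (s : S),
     (1 <= n)%N -> sigma i n (gamma s) = gamma (sigma i n s)) :
  operad_isomorphic (quotient_operad (equiv_gamma sigma_gamma))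
                    (OP (bar sigma_gamma)).
Proof.
apply: (@quotient_operad_isomorphic _ _ _ (op_class sigma_gamma)) => //.
(* Unit: both labels are the class of 0. *)
- exact: op_symbolP.
- exact: op_class_comp.
- exact: op_class_ker.
- exact: op_class_surj.
Qed.
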